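(* Consider the stochastic minimax problem $\min_{x\in\mathbb{R}^n}\max_{y\in\mathbb{R}^m}\phi(x,y)$, $\phi(x,y)=\vartheta(x)+f(x,y)-\omega(y)$, with the setting, oracle, algorithm (SAPS) and averaged iterate described in the context, and assume (A1)–(A4) hold. Let $N>0$ be an integer, let $z^1,\dots,z^N$ be generated by SAPS with a constant step size $\gamma_k\equiv\gamma$ for $k=1,\dots,N$, and let $\widetilde z^N$ be the averaged iterate. Then: (a) if $\gamma_k=1/\sqrt N$, then $\mathbb{E}[\epsilon_\phi(\widetilde z^N)]\le (\|z^1-z^*\|^2+M_*^2)/(2\sqrt N)$; (b) if $\gamma_k=\|z^1-z^*\|/(M_*\sqrt N)$, then $\mathbb{E}[\epsilon_\phi(\widetilde z^N)]\le \|z^1-z^*\|M_*/\sqrt N$; (c) if $\gamma_k=\theta\|z^1-z^*\|/(M_*\sqrt N)$ for some $\theta>0$, then $\mathbb{E}[\epsilon_\phi(\widetilde z^N)]\le \max\{\theta,\theta^{-1}\}\|z^1-z^*\|M_*/\sqrt N$.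
   Context: Setting: $\vartheta:\mathbb{R}^n\to\mathbb{R}\cup\{+\infty\}$ and $\omega:\mathbb{R}^m\to\mathbb{R}\cup\{+\infty\}$ are proper lower semicontinuous convex functions; $\xi$ is a random vector with distribution supported on $\Xi\subseteq\mathbb{R}^q$; $F:\mathbb{R}^n\times\mathbb{R}^m\times\Xi\to\mathbb{R}$, and $f(x,y)=\mathbb{E}[F(x,y,\xi)]$ is finite, continuous, convex in $x$ and concave in $y$ on $\mathbb{Z}:=\mathrm{dom}\,\vartheta\times\mathrm{dom}\,\omega$. Write $z=(x,y)$. For a proper lsc convex $h$ and $\gamma>0$, $\mathrm{Prox}_{\gamma h}(u)=\mathrm{argmin}_w\{h(w)+\frac{1}{2\gamma}\|w-u\|^2\}$. (A1) The samples $\xi_1,\xi_2,\dots$ are i.i.d. copies of $\xi$. (A2) A stochastic oracle returns, for $(x,y,\xi)\in\mathbb{Z}\times\Xi$, vectors $G_x(x,y,\xi)\in\mathbb{R}^n$, $G_y(x,y,\xi)\in\mathbb{R}^m$ such that $g_x(x,y):=\mathbb{E}[G_x(x,y,\xi)]\in\partial_x f(x,y)$ and $g_y(x,y):=\mathbb{E}[G_y(x,y,\xi)]$ satisfies $-g_y(x,y)\in\partial_y[-f](x,y)$. Write $G(z,\xi)=(G_x(z,\xi),-G_y(z,\xi))$ and $g(z)=(g_x(z),-g_y(z))$. (A3) There is $z^*=(x^*,y^* )\in\mathbb{Z}$ with $\phi(x^*,y)\le\phi(x^*,y^* )\le\phi(x,y^* )$ for all $(x,y)\in\mathbb{Z}$.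 The minimax optimality measure is $\epsilon_\phi(z)=\phi(x,y^* )-\phi(x^*,y)$. (A4) There is $M_*>0$ such that for every $z=(x,y)\in\mathbb{Z}$ there exist $v_x(x)\in\partial\vartheta(x)$, $v_y(y)\in\partial\omega(y)$ with $v(z)=(v_x(x),v_y(y))$ satisfying $\mathbb{E}[\|v(z)+G(z,\xi)\|^2]\le M_*^2$. SAPS algorithm: given $z^1=(x^1,y^1)\in\mathbb{R}^n\times\mathbb{R}^m$ and step sizes $\gamma_k>0$, for $k=1,2,\dots$: $x^{k+1}=\mathrm{Prox}_{\gamma_k\vartheta}(x^k-\gamma_kG_x(x^k,y^k,\xi_k))$, $y^{k+1}=\mathrm{Prox}_{\gamma_k\omega}(y^k+\gamma_kG_y(x^k,y^k,\xi_k))$. Averaged iterate: $\widetilde z^N=(\widetilde x^N,\widetilde y^N)=\sum_{j=1}^N\lambda_j^N z^j$ with $\lambda_j^N=\gamma_j/\sum_{i=1}^N\gamma_i$.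
   Formalization: The starting point z^1 is assumed to lie in Z = dom ϑ × dom ω (otherwise the oracle is undefined there and, e.g. for N=1, ε_φ(z^1)=+∞), and the oracles G_x, G_y are assumed jointly Borel measurable so that the expectation of ε_φ makes sense. *)

(* Defs.v *)
From HB Require Import structures.
From mathcomp Require Import all_boot all_order all_algebra.
From mathcomp Require Import all_classical all_reals all_analysis.
Set Implicit Arguments. Unset Strict Implicit. Unset Printing Implicit Defensive.
Import Order.TTheory GRing.Theory Num.Theory.
Import numFieldNormedType.Exports.
Local Open Scope classical_set_scope.
Local Open Scope ring_scope.

Section Defs.
Context {R : realType}.

Definition dotv {p : nat} (u v : 'rV[R]_p) : R := \sum_(i < p) u 0 i * v 0 i.
Definition sqn {p : nat} (u : 'rV[R]_p) : R := \sum_(i < p) (u 0 i) ^+ 2.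

Definition edom {p : nat} (h : 'rV[R]_p -> \bar R) : set 'rV[R]_p :=
  [set u | (h u < +oo)%E].

Definition proper_fun {p : nat} (h : 'rV[R]_p -> \bar R) : Prop :=
  (forall u, h u != -oo%E) /\ (exists u, h u \is a fin_num).

Definition convex_ext {p : nat} (h : 'rV[R]_p -> \bar R) : Prop :=
  forall (u w : 'rV[R]_p) (t : R), 0 < t < 1 ->
    (h (t *: u + (1 - t) *: w)%R <= t%:E * h u + (1 - t)%:E * h w)%E.

Definition is_prox {p : nat} (gam : R) (h : 'rV[R]_p -> \bar R) (u w : 'rV[R]_p) : Prop :=
  forall w', (h w + ((2 * gam)^-1 * sqn (w - u)%R)%:E <= h w' + ((2 * gam)^-1 * sqn (w' - u)%R)%:E)%E.

Definition subgrad {p : nat} (h : 'rV[R]_p -> \bar R) (u v : 'rV[R]_p) : Prop :=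
  forall w, (h u + (dotv v (w - u)%R)%:E <= h w)%E.

Definition vexpect {d} {Omega : measurableType d} (P : probability Omega R) {p : nat}
  (X : Omega -> 'rV[R]_p) : 'rV[R]_p :=
  \row_(i < p) Rintegral P setT (fun w => X w 0 i).

Definition iid_copies {d} {Omega : measurableType d} (P : probability Omega R)
  {dX} {Xi : measurableType dX} (xi : nat -> Omega -> Xi) (X : Omega -> Xi) : Prop :=
  [/\ forall k, measurable_fun setT (xi k),
      forall k (A : set Xi), (1 <= k)%N -> measurable A ->
        P (xi k @^-1` A) = P (X @^-1` A) &
      forall (J : seq nat) (A : nat -> set Xi), uniq J -> all (leq 1) J ->
        (forall j, measurable (A j)) ->
        P (\bigcap_(j in [set` J]) (xi j @^-1` A j)) = (\prod_(j <- J) P (xi j @^-1` A j))%E].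

(* joint (Borel) measurability of an oracle (x, y, s) |-> G(x, y, s), expressed
   through composition with measurable maps (coordinates of vectors) *)
Definition oracle_measurable {dX} {Xi : measurableType dX} {n m p : nat}
  (G : 'rV[R]_n -> 'rV[R]_m -> Xi -> 'rV[R]_p) : Prop :=
  forall (d' : measure_display) (T' : measurableType d')
    (X : T' -> 'rV[R]_n) (Y : T' -> 'rV[R]_m) (S : T' -> Xi),
    (forall i, measurable_fun setT (fun t => X t 0 i)) ->
    (forall i, measurable_fun setT (fun t => Y t 0 i)) ->
    measurable_fun setT S ->
    forall i, measurable_fun setT (fun t => G (X t) (Y t) (S t) 0 i).

Definition avg_iter {p : nat} (gam : nat -> R) (z : nat -> 'rV[R]_p) (N : nat) : 'rV[R]_p :=
  \sum_(1 <= j < N.+1) (gam j / \sum_(1 <= i < N.+1) gam i) *: z j.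

Definition phi {n m : nat} (th : 'rV[R]_n -> \bar R) (om : 'rV[R]_m -> \bar R)
  (f : 'rV[R]_n -> 'rV[R]_m -> R) (x : 'rV[R]_n) (y : 'rV[R]_m) : \bar R :=
  (th x + (f x y)%:E - om y)%E.

End Defs.

(* Main.v *)
Require Import Defs.
From HB Require Import structures.
From mathcomp Require Import all_boot all_order all_algebra.
From mathcomp Require Import all_classical all_reals all_analysis.
From mathcomp Require Import measurable_realfun zify ring lra.
Set Implicit Arguments. Unset Strict Implicit. Unset Printing Implicit Defensive.
Import Order.TTheory GRing.Theory Num.Theory.
Import numFieldNormedType.Exports.
Local Open Scope classical_set_scope.
Local Open Scope ring_scope.

(* For fixed z in the domain, the optimality condition of the proximal step and the
   subgradient v(z) give, for every sample s,
     |z'(s) - z*|^2 + 2 gam (theta(x) - theta(x* ) + omega(y) - omega(y* ) + <G(z,s), z - z*>)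
       <= |z - z*|^2 + gam^2 |v(z) + G(z,s)|^2.
   Averaging over s yields E |z' - z*|^2 + 2 gam eps(z) <= |z - z*|^2 + gam^2 M^2. As z^k is a
   function of the first k - 1 samples, it is independent of the k-th one, so Tonelli's
   theorem turns this into a bound on E |z^{k+1} - z*|^2 + 2 gam E eps(z^k), which
   telescopes; Jensen's inequality passes to the averaged iterate. All the integrands are
   nonnegative, so no integrability of the iterates is required. The proximal maps are
   needed at all points, not only along the trajectory, which is why their existence is
   proved; they are nonexpansive, hence measurable. *)

(** * Euclidean geometry and proximal maps *)

Section Euclidean.
Context {R : realType} {p : nat}.
Implicit Types u v w : 'rV[R]_p.

Lemma dotvC u v : dotv u v = dotv v u.
Proof. by apply: eq_bigr => i _; rewrite mulrC. Qed.

Lemma dotvDl u v w : dotv (u + v) w = dotv u w + dotv v w.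
Proof. by rewrite /dotv -big_split; apply: eq_bigr => i _; rewrite mxE mulrDl. Qed.

Lemma dotvZl (a : R) u v : dotv (a *: u) v = a * dotv u v.
Proof. by rewrite /dotv mulr_sumr; apply: eq_bigr => i _; rewrite mxE mulrA. Qed.

Lemma dotvNl u v : dotv (- u) v = - dotv u v.
Proof. by rewrite -scaleN1r dotvZl mulN1r. Qed.

Lemma dotvDr u v w : dotv w (u + v) = dotv w u + dotv w v.
Proof. by rewrite dotvC dotvDl !(dotvC _ w). Qed.

Lemma dotvZr (a : R) u v : dotv v (a *: u) = a * dotv v u.
Proof. by rewrite dotvC dotvZl dotvC. Qed.

Lemma dotvNr u v : dotv v (- u) = - dotv v u.
Proof. by rewrite dotvC dotvNl dotvC. Qed.

Lemma sqnE u : sqn u = dotv u u.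
Proof. by apply: eq_bigr => i _; rewrite expr2. Qed.

Lemma sqn_ge0 u : 0 <= sqn u.
Proof. by apply: sumr_ge0 => i _; exact: sqr_ge0. Qed.

Lemma coord_sqn_le u i : (u 0 i) ^+ 2 <= sqn u.
Proof.
by rewrite /sqn (bigD1 i)//= lerDl sumr_ge0// => j _; exact: sqr_ge0.
Qed.

Lemma sqn_eq0 u : sqn u = 0 -> u = 0.
Proof.
move=> u0; apply/rowP => i; rewrite mxE; apply/eqP.
by rewrite -sqrf_eq0 eq_le sqr_ge0 andbT -u0 coord_sqn_le.
Qed.

(** Balls of row vectors are those of the sup norm; this bound and [sqn_lt_ball] pass between them
    and Euclidean distances. *)
Lemma ball_sqn u v e : ball u e v -> sqn (u - v) <= p%:R * e ^+ 2.
Proof.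
move=> [e0 uv]; rewrite mulr_natl -[X in _ *+ X]card_ord -sumr_const.
apply: ler_sum => i _; rewrite !mxE -[leLHS]real_normK ?num_real//.
have := uv 0 i; rewrite /ball/= => /ltW uvi.
by rewrite lerXn2r ?nnegrE// ltW.
Qed.

Lemma near_sqn u e : 0 < e -> \forall v \near u, sqn (u - v) < e.
Proof.
move=> e0; have p0 : 0 < p%:R + 1 :> R by rewrite ltr_wpDl.
(* The [+ 1] covers [p] = 0 and makes the final inequality strict. *)
pose s := Num.sqrt (e / (p%:R + 1)).
have s0 : 0 < s by rewrite sqrtr_gt0 divr_gt0.
apply/nbhs_ballP; exists s => //= v /ball_sqn /le_lt_trans; apply.
by rewrite sqr_sqrtr ?divr_ge0 1?ltW// mulrCA gtr_pMr// ltr_pdivrMr// mul1r ltrDl.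
Qed.

Lemma sqn_lt_ball u v e : 0 < e -> sqn (u - v) < e ^+ 2 -> ball u e v.
Proof.
move=> e0 uv; split=> // i j; rewrite (ord1 i) /ball/=.
have := le_lt_trans (coord_sqn_le (u - v) j) uv.
by rewrite !mxE -ltr_sqrt ?exprn_gt0// !sqrtr_sqr (gtr0_norm e0).
Qed.

(** Symmetry is left out because it would loop as a rewrite rule; each use adds the instances of
    [dotvC] that give both orders of a pair the same form. *)
Definition dotvE := (@sqnE, dotvDl, dotvDr, dotvNl, dotvNr, dotvZl, dotvZr).

End Euclidean.

Section Prox.
Context {R : realType} {p : nat}.
Implicit Types (h : 'rV[R]_p -> \bar R) (u v w : 'rV[R]_p).

Lemma edom_fineK h u : proper_fun h -> edom h u -> (fine (h u))%:E = h u.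
Proof. by move=> [hNy _] hu; rewrite fineK// fin_numE hNy lt_eqF. Qed.

Lemma convex_fine h u w (t : R) : proper_fun h -> convex_ext h ->
  edom h u -> edom h w -> 0 < t < 1 ->
  edom h (t *: u + (1 - t) *: w) /\
  fine (h (t *: u + (1 - t) *: w)) <= t * fine (h u) + (1 - t) * fine (h w).
Proof.
move=> ph ch hu hw t01; have := ch u w t t01.
rewrite -(edom_fineK ph hu) -(edom_fineK ph hw) -!EFinM -EFinD => le.
have d : edom h (t *: u + (1 - t) *: w) by exact: le_lt_trans le (ltry _).
by split=> //; move: le; rewrite -(edom_fineK ph d) lee_fin.
Qed.

Lemma subgrad_fine h u v w : proper_fun h -> edom h u -> edom h w ->
  subgrad h u v -> fine (h u) + dotv v (w - u) <= fine (h w).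
Proof.
move=> ph hu hw /(_ w).
by rewrite -(edom_fineK ph hu) -(edom_fineK ph hw) -EFinD lee_fin.
Qed.

Lemma prox_edom (gam : R) h u w : proper_fun h -> is_prox gam h u w -> edom h w.
Proof.
move=> [hNy [u0 u0fin]] /(_ u0) le; rewrite /edom /=.
move: le; rewrite -(fineK u0fin) -EFinD.
by case: (h w) => [r|//|] _; rewrite ?ltry// addye// leye_eq.
Qed.

Lemma prox_fine (gam : R) h u w w' : proper_fun h -> is_prox gam h u w -> edom h w' ->
  fine (h w) + (2 * gam)^-1 * sqn (w - u) <=
  fine (h w') + (2 * gam)^-1 * sqn (w' - u).
Proof.
move=> ph hw hw'; have := hw w'.
by rewrite -(edom_fineK ph hw') -(edom_fineK ph (prox_edom ph hw)) -!EFinD lee_fin.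
Qed.

(** The limit t -> 0 by hand: if a > 0, then t = 1/2 forces b > 0, and t = a / (a + b) gives a (a +
    b) <= a b, which is absurd. *)
Lemma le_of_small_slope (a b : R) :
  (forall t, 0 < t < 1 -> a <= t * b) -> a <= 0.
Proof.
move=> ab; rewrite leNgt; apply/negP => a0.
have b0 : 0 < b.
  have := ab (2^-1) ltac:(lra); lra.
have : 0 < a / (a + b) < 1.
  by rewrite divr_gt0 ?addr_gt0//= ltr_pdivrMr ?addr_gt0// mul1r ltrDl.
move=> /ab; rewrite mulrAC ler_pdivlMr ?addr_gt0//; nra.
Qed.

(* The optimality condition (u - w) / gam \in \partial h(w), obtained by moving from the
   minimiser w a small step t towards w'. *)
Lemma prox_subgrad (gam : R) h u w w' : 0 < gam -> proper_fun h -> convex_ext h ->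
  is_prox gam h u w -> edom h w' ->
  fine (h w) + gam^-1 * dotv (u - w) (w' - w) <= fine (h w').
Proof.
move=> gam0 ph ch hw hw'; have hwd := prox_edom ph hw.
rewrite -subr_le0.
apply: (@le_of_small_slope _ ((2 * gam)^-1 * sqn (w' - w))) => t t01.
have [d cv] := convex_fine ph ch hw' hwd t01.
have := prox_fine ph hw d.
have -> : sqn (t *: w' + (1 - t) *: w - u) =
    sqn (w - u) - 2 * t * dotv (u - w) (w' - w) + t ^+ 2 * sqn (w' - w).
  rewrite !dotvE (dotvC w w') (dotvC w u) (dotvC w' u); ring.
have -> : (2 * gam)^-1 = gam^-1 / 2 by rewrite invfM mulrC.
move: cv t01; set A := dotv _ _; set S := sqn (w' - w); set S' := sqn _.
set g := gam^-1; set a := fine (h w); set b := fine (h w'); set c := fine _.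
move=> cv t01 le.
(* Minimality at the convex combination, its convexity bound and the expanded square: every
   remaining term has a factor t, which is then cancelled. *)
have : t * (a + g * A - b) <= t * (t * (g / 2 * S)) by nra.
by rewrite ler_pM2l//; case/andP: t01.
Qed.

(** Adding the optimality conditions at w and w' gives |w - w'|^2 <= <u - u', w - w'>; the
    nonnegative square of (u - u') - (w - w') does the rest. *)
Lemma prox_nonexpansive (gam : R) h u u' w w' : 0 < gam -> proper_fun h -> convex_ext h ->
  is_prox gam h u w -> is_prox gam h u' w' -> sqn (w - w') <= sqn (u - u').
Proof.
move=> gam0 ph ch hw hw'.
have := prox_subgrad gam0 ph ch hw (prox_edom ph hw').
have := prox_subgrad gam0 ph ch hw' (prox_edom ph hw).
move=> h1 h2.
have : gam^-1 * (dotv (u - w) (w' - w) + dotv (u' - w') (w - w')) <= 0 by lra.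
rewrite pmulr_rle0 ?invr_gt0//.
have := sqn_ge0 ((u - u') - (w - w')).
rewrite !dotvE (dotvC w u) (dotvC w' u) (dotvC u' u) (dotvC w u') (dotvC w' u')
  (dotvC w' w); lra.
Qed.

Lemma prox_unique (gam : R) h u w w' : 0 < gam -> proper_fun h -> convex_ext h ->
  is_prox gam h u w -> is_prox gam h u w' -> w = w'.
Proof.
move=> gam0 ph ch hw hw'; apply/eqP; rewrite -subr_eq0; apply/eqP/sqn_eq0/eqP.
rewrite eq_le sqn_ge0 andbT.
have := prox_nonexpansive gam0 ph ch hw hw'.
by rewrite subrr [sqn 0]big1// => i _; rewrite mxE expr0n.
Qed.

(* One step of the method against the reference point xs, with v a subgradient at the
   current point: no regularity of the choice of v is needed. *)
Lemma prox_step (gam : R) h x v g w xs : 0 < gam -> proper_fun h -> convex_ext h ->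
  edom h x -> edom h xs -> subgrad h x v -> is_prox gam h (x - gam *: g) w ->
  sqn (w - xs) + 2 * gam * (fine (h x) - fine (h xs) + dotv g (x - xs)) <=
  sqn (x - xs) + gam ^+ 2 * sqn (v + g).
Proof.
move=> gam0 ph ch hx hxs sv hw.
have hwd := prox_edom ph hw.
have h1 := prox_subgrad gam0 ph ch hw hxs.
have h2 := subgrad_fine ph hx hwd sv.
(* The two inequalities above leave - |w - x|^2 - 2 gam <v + g, w - x> on the right; this square
   bounds it by gam^2 |v + g|^2. *)
have := sqn_ge0 (gam *: (v + g) + (w - x)).
move: h1 h2; set a := fine _; set b := fine _; set c := fine _.
rewrite -(ler_pM2l gam0) mulrDr mulVKf ?gt_eqF// => h1.
rewrite -(ler_pM2l gam0) => h2; move: h1 h2.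
rewrite !dotvE (dotvC w v) (dotvC x v) (dotvC g v) (dotvC w g) (dotvC x g)
  ?(dotvC xs x) (dotvC xs w) (dotvC w x).
lra.
Qed.

End Prox.

(** * Existence of proximal points *)

Section ProxExistence.
Context {R : realType} {p : nat}.
Implicit Types (h : 'rV[R]_p -> \bar R) (u v w : 'rV[R]_p).

(* A minimising sequence is Cauchy by the parallelogram identity, so no compactness is
   needed; the affine minorant given by one subgradient bounds the objective below. *)
Lemma prox_exists (gam : R) h u u0 v0 : 0 < gam -> proper_fun h ->
  lower_semicontinuous h -> convex_ext h -> edom h u0 -> subgrad h u0 v0 ->
  exists w, is_prox gam h u w.
Proof.
move=> gam0 ph lh ch hu0 sv0.
pose c : R := (2 * gam)^-1.
have c0 : 0 < c by rewrite invr_gt0 mulr_gt0.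
pose Q w := fine (h w) + c * sqn (w - u).
pose S := [set Q w | w in edom h].
have S0 : S !=set0 by exists (Q u0), u0.
have hiS : has_inf S.
  (* The bound comes from completing the square in c |w - u|^2 + <v0, w - u>. *)
  split=> //; exists (fine (h u0) + dotv v0 (u - u0) - (4 * c)^-1 * sqn v0).
  move=> _ [w hw <-]; rewrite /Q.
  have := subgrad_fine ph hu0 hw sv0.
  have := sqn_ge0 (2 * c *: (w - u) + v0).
  have -> : sqn (2 * c *: (w - u) + v0) =
      4 * c * (c * sqn (w - u) + dotv v0 (w - u) + (4 * c)^-1 * sqn v0).
    have c0' : c != 0 by rewrite gt_eqF.
    rewrite !dotvE (dotvC w v0) (dotvC u v0); by field.
  rewrite pmulr_rge0 ?mulr_gt0// (_ : w - u0 = (w - u) + (u - u0)); last by rewrite subrKA.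
  rewrite (dotvDr (w - u)); lra.
pose I := inf S.
have QI w : edom h w -> I <= Q w by move=> hw; apply: ge_inf; [case: hiS|exists w].
have /choice[wk wkP] : forall k : nat, exists w, edom h w /\ Q w < I + k.+1%:R^-1.
  move=> k; have [|_ [w hw <-] Qw] := @inf_adherent _ S k.+1%:R^-1 _ hiS.
    by rewrite invr_gt0.
  by exists w.
(* At the midpoint Q is at least [I], while both endpoints are nearly optimal. *)
have close j k : (c / 4) * sqn (wk j - wk k) <= (j.+1%:R^-1 + k.+1%:R^-1) / 2.
  have [hj Qj] := wkP j; have [hk Qk] := wkP k.
  have t01 : 0 < (2^-1 : R) < 1 by lra.
  have [hm le] := convex_fine ph ch hj hk t01.
  have := QI _ hm; rewrite /Q.
  have -> : sqn (2^-1 *: wk j + (1 - 2^-1) *: wk k - u) =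
      sqn (wk j - u) / 2 + sqn (wk k - u) / 2 - sqn (wk j - wk k) / 4.
    rewrite !dotvE (dotvC (wk k) (wk j)) (dotvC (wk k) u) (dotvC (wk j) u); by field.
  move: Qj Qk le; rewrite /Q; move: (j.+1%:R^-1) (k.+1%:R^-1) => ej ek; lra.
have /cvg_ex[/= w wkw] : cvg (wk @ \oo).
  apply/cauchy_cvgP/cauchy_ballP => e e0; near_simpl.
  have d0 : 0 < c / 4 * e ^+ 2 by rewrite mulr_gt0 ?divr_gt0 ?exprn_gt0.
  near=> jk; apply: sqn_lt_ball => //.
  rewrite -(ltr_pM2l (_ : 0 < c / 4)) ?divr_gt0//.
  apply: (le_lt_trans (close _ _)).
  have : (jk.1.+1%:R^-1 : R) < c / 4 * e ^+ 2.
    near: jk; exists ([set k : nat | (k.+1%:R^-1 : R) < c / 4 * e ^+ 2], setT) => /=.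
      by split; [exact: (near_infty_natSinv_lt (PosNum d0))|exact: filterT].
    by move=> [a b] /= [].
  have : (jk.2.+1%:R^-1 : R) < c / 4 * e ^+ 2.
    near: jk; exists (setT, [set k : nat | (k.+1%:R^-1 : R) < c / 4 * e ^+ 2]) => /=.
      by split; [exact: filterT|exact: (near_infty_natSinv_lt (PosNum d0))].
    by move=> [a b] /= [].
  move: (jk.1.+1%:R^-1) (jk.2.+1%:R^-1) => a b; lra.
exists w => w'.
suff Qw : (h w + (c * sqn (w - u))%:E <= I%:E)%E.
  have [hw'|hw'] := boolP (h w' < +oo)%E; last first.
    by move: hw'; rewrite -leNgt leye_eq => /eqP ->; rewrite addye// leey.
  apply: (le_trans Qw); rewrite -(edom_fineK ph hw') -EFinD lee_fin.
  exact: QI.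
rewrite leNgt; apply/negP => Iw.
pose s := sqn (w - u).
(* A real threshold below h w treats finite and infinite values of h w alike; lower semicontinuity
   keeps h (wk k) above [a] eventually. *)
have [a [aw Ia]] : exists a, (a%:E < h w)%E /\ I < a + c * s.
  move: Iw; rewrite -/s; case E : (h w) => [r| |] Iw.
  - exists ((r + (I - c * s)) / 2); rewrite lte_fin.
    by move: Iw; rewrite -EFinD lte_fin; split; lra.
  - by exists (I - c * s + 1); rewrite ltry; split=> //; lra.
  - by case: ph => /(_ w); rewrite E.
pose e := (a + c * s - I) / 2.
have e0 : 0 < e by rewrite divr_gt0// subr_gt0.
have eE : 2 * e = a + c * s - I by rewrite /e; field.
clearbody e.
have [V Vw Va] := lh _ _ aw.
have : \forall k \near \oo, False.
  have cs0 : 0 <= c * s by rewrite mulr_ge0 ?sqn_ge0 ?ltW.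
  have cse0 : 0 < c * s + e by lra.
  (* Parameter of the Young inequality [young], chosen so that c t s is at most e / 4. Three errors
     of at most e / 4 cannot fill the gap 2 e between [I] and a + c s. *)
  pose t := e / (4 * (c * s + e)).
  have t0 : 0 < t by rewrite divr_gt0// mulr_gt0.
  have cts : c * t * s <= e / 4.
    have -> : c * t * s = c * s * e / (4 * (c * s + e)) by rewrite /t; ring.
    rewrite ler_pdivrMr ?mulr_gt0//; nra.
  clearbody t; near=> k.
  have [hk Qk] := wkP k.
  have hak : a < fine (h (wk k)).
    by rewrite -lte_fin edom_fineK//; apply: Va; near: k; exact: wkw.
  have k1 : (k.+1%:R^-1 : R) < e / 4.
    by near: k; apply: (near_infty_natSinv_lt (PosNum (_ : 0 < e / 4))); rewrite divr_gt0.
  have near_wk : sqn (w - wk k) < t * (e / (4 * c)).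
    near: k; apply: (wkw _ (near_sqn w _)).
    by rewrite mulr_gt0// divr_gt0// mulr_gt0.
  have young : c * s <= c * sqn (wk k - u) + c * t * s + c * (t^-1 * sqn (w - wk k)).
    rewrite -!mulrA -!mulrDr ler_pM2l// -(ler_pM2l t0).
    rewrite [leRHS]mulrDr mulVKf ?gt_eqF// /s.
    have := sqn_ge0 (t *: (w - u) - (w - wk k)).
    have := mulr_ge0 (ltW t0) (sqn_ge0 (w - wk k)).
    rewrite !dotvE (dotvC u w) (dotvC (wk k) w) (dotvC u (wk k)); lra.
  have : c * (t^-1 * sqn (w - wk k)) < e / 4.
    rewrite mulrCA ltr_pdivrMl//; move: near_wk; rewrite -(ltr_pM2l c0).
    suff -> : c * (t * (e / (4 * c))) = t * (e / 4) by [].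
    by field; rewrite gt_eqF.
  move: Qk k1 young; rewrite /Q -/s; move: (k.+1%:R^-1) => b; lra.
by case=> n _ /(_ n)/(_ (leqnn _)).
Unshelve. all: by end_near.
Qed.

End ProxExistence.

(** * Measurability of vector-valued maps *)

(** The coordinate form matches [oracle_measurable], so no sigma-algebra on row vectors has to be
    fixed. *)
Definition rV_measurable {R : realType} {d} {T : measurableType d} {p : nat}
  (U : T -> 'rV[R]_p) := forall i, measurable_fun setT (fun t => U t 0 i).

Section RVMeasurable.
Context {R : realType} {d} {T : measurableType d} {p : nat}.
Implicit Types U V : T -> 'rV[R]_p.

Lemma rV_measurableD U V : rV_measurable U -> rV_measurable V ->
  rV_measurable (fun t => U t + V t).
Proof.
move=> mU mV i; under eq_fun do rewrite mxE; exact: measurable_funD.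
Qed.

Lemma rV_measurableZ (a : R) U : rV_measurable U -> rV_measurable (fun t => a *: U t).
Proof.
move=> mU i; under eq_fun do rewrite mxE; exact: measurable_funM.
Qed.

Lemma rV_measurableN U : rV_measurable U -> rV_measurable (fun t => - U t).
Proof.
by move=> mU; under [X in rV_measurable X]eq_fun do rewrite -scaleN1r; exact: rV_measurableZ.
Qed.

Lemma rV_measurable_cst (u : 'rV[R]_p) : rV_measurable (fun _ : T => u).
Proof. by move=> i; exact: measurable_cst. Qed.

Lemma rV_measurable_sum {I : Type} (s : seq I) (V : I -> T -> 'rV[R]_p) :
  (forall j, rV_measurable (V j)) -> rV_measurable (fun t => \sum_(j <- s) V j t).
Proof.
move=> mV i; under eq_fun do rewrite summxE; apply: measurable_sum => j; exact: mV.
Qed.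

Lemma measurable_sqn U : rV_measurable U -> measurable_fun setT (fun t => sqn (U t)).
Proof. by move=> mU; apply: measurable_sum => i; exact: measurable_funX. Qed.

(* Balls for the sup norm are boxes; those with rational centre and radius 1/(k+1)
   contained in the open set O cover it. *)
Lemma rV_measurable_open U (O : set 'rV[R]_p) : rV_measurable U -> open O ->
  measurable (U @^-1` O).
Proof.
move=> mU oO.
pose B (c : 'rV[rat]_p * nat) := ball (map_mx ratr c.1 : 'rV[R]_p) c.2.+1%:R^-1.
pose F c := if `[< B c `<=` O >] then U @^-1` B c else set0.
have -> : U @^-1` O = \bigcup_c F c.
  apply/seteqP; split=> [t Ot|t [c _]]; last first.
    by rewrite /F; case: asboolP => // BO; exact: BO.
  have /nbhs_ballP[e /= e0 eO] := open_nbhs_nbhs (conj oO Ot).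
  (* Radius below e / 2: a point of the box is that close to the centre, which is that close to
     [U t]. *)
  have [k _ /(_ k (leqnn k)) /= ke] := near_infty_natSinv_lt (PosNum (divr_gt0 e0 (ltr0n _ 2))).
  set r : R := k.+1%:R^-1 in ke.
  have r0 : 0 < r by rewrite invr_gt0.
  have /choice[q qP] i : exists q : rat, ratr q \in `](U t 0 i - r), (U t 0 i + r)[.
    by apply: rat_in_itvoo; lra.
  have Bt : B (\row_i q i, k) (U t).
    split=> // i j; rewrite (ord1 i) /ball/= !mxE.
    by have := qP j; rewrite in_itv/= ltr_norml -/r => /andP[]; move: (ratr _) => z; lra.
  exists (\row_i q i, k) => //; rewrite /F; case: asboolP => // nBO.
  case: nBO => v Bv; apply: eO; rewrite [e](splitr e).
  apply: (@ball_triangle _ _ (map_mx ratr (\row_i q i) : 'rV[R]_p)).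
    by apply: ball_sym; apply: le_ball Bt => /=; exact: ltW.
  by apply: le_ball Bv => /=; exact: ltW.
apply: countable_bigcupT_measurable; first exact: countableP.
move=> c; rewrite /F; case: asboolP => // _.
have -> : U @^-1` B c =
    \bigcap_(i in [set: 'I_p]) ((fun t => U t 0 i) @^-1` ball (ratr (c.1 0 i) : R) c.2.+1%:R^-1).
  apply/seteqP; split=> [t [_ Bt] i _|t Bt]; first by have := Bt 0 i; rewrite mxE.
  split=> [|i j]; first by rewrite invr_gt0.
  by rewrite (ord1 i) mxE; exact: Bt.
apply: fin_bigcap_measurable => // i _.
by rewrite -[X in measurable X]setTI; apply: mU => //; exact: measurable_ball.
Qed.

(** With lower semicontinuity only relative to [D], the set where D u implies a < g u need not be
    open, but its interior contains every point of [D] with a < g u, and [U] stays in [D]. *)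
Lemma measurable_lsc_within U (D : set 'rV[R]_p) (g : 'rV[R]_p -> R) :
  rV_measurable U -> (forall t, D (U t)) ->
  (forall a u, D u -> a < g u -> \forall v \near u, D v -> a < g v) ->
  measurable_fun setT (fun t => g (U t)).
Proof.
move=> mU DU lg; apply: (measurability _ (RGenOInfty.measurableE R)).
move=> /= _ [_ [a ->]] <-; rewrite setTI.
rewrite (_ : _ @^-1` _ = U @^-1` (interior [set u | D u -> a < g u])).
  by apply: rV_measurable_open => //; exact: open_interior.
apply/seteqP; split=> [t /=|t /= /interior_subset /= /(_ (DU t))].
  by rewrite in_itv/= andbT => agU; exact: lg.
by rewrite in_itv/= andbT.
Qed.

Lemma measurable_fine_lsc U (h : 'rV[R]_p -> \bar R) :
  rV_measurable U -> proper_fun h -> lower_semicontinuous h -> (forall t, edom h (U t)) ->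
  measurable_fun setT (fun t => fine (h (U t))).
Proof.
move=> mU ph lh hU.
apply: (@measurable_lsc_within _ _ (fun u => fine (h u)) mU hU) => a u hu.
rewrite -lte_fin edom_fineK// => /lh[V uV aV].
by apply: filterS uV => v /aV av hv; rewrite -lte_fin edom_fineK.
Qed.

Lemma measurable_continuous_within U (D : set 'rV[R]_p) (g : 'rV[R]_p -> R) :
  rV_measurable U -> (forall t, D (U t)) ->
  {within D, continuous g} -> measurable_fun setT (fun t => g (U t)).
Proof.
move=> mU DU /subspace_continuousP cg.
apply: (measurable_lsc_within mU DU) => a u Du agu.
exact: (cg u Du _ (lt_nbhsr agu)).
Qed.

Lemma rV_measurable_nonexpansive U {q : nat} (Pr : 'rV[R]_p -> 'rV[R]_q) :
  (forall u v, sqn (Pr u - Pr v) <= sqn (u - v)) ->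
  rV_measurable U -> rV_measurable (fun t => Pr (U t)).
Proof.
move=> nPr mU i.
apply: (@measurable_lsc_within _ setT (fun u => Pr u 0 i) mU) => // a u _ aPr.
have e0 : 0 < (Pr u 0 i - a) ^+ 2 by rewrite exprn_gt0// subr_gt0.
near=> v => _.
have : sqn (u - v) < (Pr u 0 i - a) ^+ 2 by near: v; exact: near_sqn.
have := le_trans (coord_sqn_le (Pr u - Pr v) i) (nPr u v).
rewrite !mxE; nra.
Unshelve. all: by end_near. Qed.

End RVMeasurable.

(** * Independence of the past and the next sample *)

Section Freezing.
Context {R : realType} {d dT dX : measure_display} {Omega : measurableType d}
  {T : measurableType dT} {Xi : measurableType dX} (P : probability Omega R).

(** The product rule on rectangles identifies the law of (Z, S) with the product of the laws of Z
    and S0; Tonelli then integrates over the sample with Z frozen. Taking A = [setT] shows that the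
    rule includes equality in law of S and S0. *)
Lemma integral_independent (Z : Omega -> T) (S S0 : Omega -> Xi) (H : T * Xi -> \bar R) :
  measurable_fun setT Z -> measurable_fun setT S -> measurable_fun setT S0 ->
  (forall A B, measurable A -> measurable B ->
     P (Z @^-1` A `&` S @^-1` B) = (P (Z @^-1` A) * P (S0 @^-1` B))%E) ->
  measurable_fun setT H -> (forall z, 0 <= H z)%E ->
  (\int[P]_w H (Z w, S w) = \int[P]_w \int[P]_w' H (Z w, S0 w'))%E.
Proof.
move=> mZ mS mS0 ind mH H0.
have mZS : measurable_fun setT (fun w => (Z w, S w)) by exact: measurable_fun_pair.
pose Zm : {mfun Omega >-> T} := HB.pack Z (isMeasurableFun.Build _ _ _ _ _ mZ).
pose Sm : {mfun Omega >-> Xi} := HB.pack S0 (isMeasurableFun.Build _ _ _ _ _ mS0).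
pose ZSm : {mfun Omega >-> (T * Xi)%type} :=
  HB.pack (fun w => (Z w, S w)) (isMeasurableFun.Build _ _ _ _ _ mZS).
have law := @product_measure_unique _ _ _ _ R (distribution P Zm) (distribution P Sm)
  (distribution P ZSm) ind.
transitivity (\int[distribution P ZSm]_z H z)%E.
  by rewrite ge0_integral_pushforward.
rewrite (eq_measure_integral (distribution P Zm \x distribution P Sm)%E); last first.
  by move=> A mA _; exact/esym/law.
rewrite fubini_tonelli1// ge0_integral_pushforward//.
- apply: eq_integral => w _ /=; rewrite /fubini_F ge0_integral_pushforward//.
  exact: (measurableT_comp mH (measurable_pair1 _)).
- exact: measurable_fun_fubini_tonelli_F.
- by move=> z _; apply: integral_ge0.
Qed.

End Freezing.

Section Past.
Context {R : realType} {d dX : measure_display} {Omega : measurableType d}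
  {Xi : measurableType dX} (P : probability Omega R).
Variables (xi : nat -> Omega -> Xi) (xi0 : Omega -> Xi).
Hypothesis iid : iid_copies P xi xi0.
Hypothesis mxi0 : measurable_fun setT xi0.

(* A pi-system generating the sigma-algebra of (xi 1, ..., xi k). *)
Definition past (k : nat) : set (set Omega) :=
  [set C | exists2 A : nat -> set Xi, (forall j, measurable (A j)) &
     C = \bigcap_(j in [set` iota 1 k]) (xi j @^-1` A j)].

Let mxi k : measurable_fun setT (xi k).
Proof. by case: iid. Qed.

Lemma past_setI k : setI_closed (past k).
Proof.
move=> _ _ [A mA ->] [B mB ->]; exists (fun j => A j `&` B j).
  by move=> j; exact: measurableI.
by rewrite -bigcapI; apply: eq_bigcapr => j _; rewrite preimage_setI.
Qed.

Lemma past_setT k : past k setT.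
Proof. exists (fun=> setT) => //; apply/seteqP; split=> //. Qed.

Lemma past_measurable k : past k `<=` measurable.
Proof.
move=> _ [A mA ->]; apply: fin_bigcap_measurable; first exact: finite_seq.
by move=> j _; rewrite -[X in measurable X]setTI; exact: mxi.
Qed.

Lemma sigma_past_measurable k : <<s past k >> `<=` @measurable _ Omega.
Proof.
apply: smallest_sub; first exact: sigma_algebra_measurable.
exact: past_measurable.
Qed.

Let set_iota1 k j : [set` iota 1 k] j = (1 <= j <= k)%N :> Prop.
Proof. by rewrite -[LHS]/(is_true (j \in iota 1 k)) mem_iota add1n ltnS. Qed.

Lemma past_subS k : past k `<=` past k.+1.
Proof.
move=> _ [A mA ->]; exists (fun j => if (j <= k)%N then A j else setT).
  by move=> j; case: ifP.
apply/seteqP; split=> w Aw j; rewrite set_iota1 => jk.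
  by rewrite /preimage /=; case: ifP => // jk'; apply: Aw; rewrite set_iota1; lia.
have := Aw j; rewrite set_iota1 /preimage /= (_ : (j <= k)%N); last by lia.
by apply; lia.
Qed.

Lemma past_next k B : measurable B -> past k.+1 (xi k.+1 @^-1` B).
Proof.
move=> mB; exists (fun j => if j == k.+1 then B else setT).
  by move=> j; case: ifP.
apply/seteqP; split=> [w Bw j _ /=|w /(_ k.+1)]; rewrite ?set_iota1 /preimage /=.
  by case: eqP => // ->.
by rewrite eqxx; apply; lia.
Qed.

(** As functions of C both sides are finite measures, a restriction of [P] and a multiple of [P], so
    agreement on the pi-system [past k] is enough. *)
Lemma past_independent k C B : <<s past k >> C -> measurable B ->
  P (C `&` xi k.+1 @^-1` B) = (P C * P (xi0 @^-1` B))%E.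
Proof.
move=> sC mB.
have mxiB : measurable (xi k.+1 @^-1` B) by rewrite -[X in measurable X]setTI; exact: mxi.
have mxi0B : measurable (xi0 @^-1` B) by rewrite -[X in measurable X]setTI; exact: mxi0.
have r0 : 0 <= fine (P (xi0 @^-1` B)) by exact: fine_ge0.
transitivity (mscale (NngNum r0) P C); last first.
  by rewrite /mscale/= muleC fineK// fin_num_measure.
rewrite -[LHS]/(mrestr P mxiB C).
apply: (g_sigma_algebra_measure_unique (past k) (@past_measurable k) (fun=> setT)) sC => //.
- by move=> _; exact: past_setT.
- by rewrite bigcup_const.
- exact: past_setI.
- move=> _ [A mA ->] /=; rewrite /mrestr /mscale /= [RHS]muleC fineK ?fin_num_measure//.
  have [_ law ind] := iid.
  have kN : k.+1 \notin iota 1 k by rewrite mem_iota; lia.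
  have pos : all (leq 1) (k.+1 :: iota 1 k).
    by rewrite /=; apply/allP => j; rewrite mem_iota => /andP[].
  (* Adding [J] at index k + 1 writes a past event and a condition on the next sample as one event,
     to which the product rule of [iid] applies. *)
  pose A' J j := if j == k.+1 then J else A j.
  have mA' J j : measurable J -> measurable (A' J j) by rewrite /A'; case: ifP.
  have A'E J j : j \in iota 1 k -> A' J j = A j.
    by rewrite /A'; case: eqP => // ->; rewrite (negPf kN).
  have capE J : \bigcap_(j in [set` k.+1 :: iota 1 k]) (xi j @^-1` A' J j) =
      \bigcap_(j in [set` iota 1 k]) (xi j @^-1` A j) `&` xi k.+1 @^-1` J.
    apply/seteqP; split=> w.
      move=> Aw; split=> [j /= jk|].
        by have := Aw j; rewrite /= in_cons jk orbT A'E//; exact.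
      by have := Aw k.+1; rewrite /= mem_head /A' eqxx; exact.
    move=> [Aw Jw] j /=; rewrite in_cons => /orP[/eqP ->|jk].
      by rewrite /A' eqxx.
    by rewrite A'E//; exact: Aw.
  have prodE J : measurable J ->
      P (\bigcap_(j in [set` iota 1 k]) (xi j @^-1` A j) `&` xi k.+1 @^-1` J) =
      (P (xi0 @^-1` J) * \prod_(j <- iota 1 k) P (xi j @^-1` A j))%E.
    move=> mJ; rewrite -capE ind//=.
    - rewrite big_cons {1}/A' eqxx law//; congr (_ * _)%E.
      by apply: eq_big_seq => j jk; rewrite A'E.
    - by rewrite kN iota_uniq.
    - by move=> j; exact: mA'.
  rewrite prodE// muleC; congr (_ * _)%E.
  (* With J = [setT] the same identity evaluates the probability of the past event alone. *)
  have := prodE setT measurableT; rewrite preimage_setT setIT => ->.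
  by rewrite preimage_setT probability_setT mul1e.
- by move=> _ /=; rewrite /mrestr setTI (le_lt_trans (probability_le1 _ _))// ltry.
Qed.

(** The past is the identity of Omega, read as a map into Omega with the smaller sigma-algebra;
    joint measurability for it expresses that H sees w only through the first k samples. *)
Lemma integral_past k (H : Omega -> Xi -> \bar R) :
  measurable_fun setT (fun z : g_sigma_algebraType (past k) * Xi => H z.1 z.2) ->
  (forall w s, 0 <= H w s)%E ->
  (\int[P]_w H w (xi k.+1 w) = \int[P]_w \int[P]_w' H w (xi0 w'))%E.
Proof.
move=> mH H0.
apply: (@integral_independent _ _ _ _ _ (g_sigma_algebraType (past k)) _ P id
  (xi k.+1) xi0 (fun z => H z.1 z.2)) => //.
- by move=> _ A mA; rewrite setTI; exact: (@sigma_past_measurable k).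
- by move=> A B mA mB; exact: past_independent.
Qed.

Lemma measurable_pastS k d' (T' : measurableType d') (g : Omega -> T') :
  measurable_fun setT (g : g_sigma_algebraType (past k) -> T') ->
  measurable_fun setT (g : g_sigma_algebraType (past k.+1) -> T').
Proof.
move=> mg _ A mA; have := mg measurableT A mA.
exact: (sub_smallest2r _ (@past_subS k)).
Qed.

Lemma measurable_past k d' (T' : measurableType d') (g : Omega -> T') :
  measurable_fun setT (g : g_sigma_algebraType (past k) -> T') ->
  measurable_fun setT g.
Proof.
by move=> mg _ A mA; apply: (@sigma_past_measurable k); exact: mg.
Qed.

Lemma measurable_past_next k :
  measurable_fun setT (xi k.+1 : g_sigma_algebraType (past k.+1) -> Xi).
Proof.
by move=> _ A mA; rewrite setTI; apply: sub_sigma_algebra; exact: past_next.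
Qed.

End Past.

(** * Expectations of linear forms, and convexity along averages *)

Lemma expect_dotv {R : realType} {d} {Omega : measurableType d} (P : probability Omega R)
  {p : nat} (X : Omega -> 'rV[R]_p) (u : 'rV[R]_p) :
  (forall i, P.-integrable setT (fun w => (X w 0 i)%:E)) ->
  P.-integrable setT (fun w => (dotv (X w) u)%:E) /\
  Rintegral P setT (fun w => dotv (X w) u) = dotv (vexpect P X) u.
Proof.
move=> iX.
have E : (fun w => (dotv (X w) u)%:E) =
    (fun w => \sum_(i < p) (u 0 i)%:E * (X w 0 i)%:E)%E.
  apply/funext => w; rewrite /dotv -sumEFin; apply: eq_bigr => i _.
  by rewrite -EFinM mulrC.
split; first by rewrite E; apply: integrable_sum => // i _; exact: integrableZl.
rewrite /Rintegral E integral_sum//; last by move=> i; exact: integrableZl.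
rewrite -sum_fine; last first.
  move=> i _; rewrite integralZl// fin_numM// integrable_fin_num//; exact: iX.
apply: eq_bigr => i _; rewrite integralZl// fineM//; last exact: integrable_fin_num.
by rewrite mxE mulrC.
Qed.

(** Induction on N: with a = N + 1, the next mean combines the current one, with weight a / (a + 1),
    and the new point. Membership in [D] is carried along because convexity is assumed only
    there. *)
Lemma jensen_mean {R : realType} {p : nat} (D : set 'rV[R]_p) (g : 'rV[R]_p -> R)
  (z : nat -> 'rV[R]_p) (N : nat) :
  (forall u w t, D u -> D w -> 0 < t < 1 -> D (t *: u + (1 - t) *: w) /\
     g (t *: u + (1 - t) *: w) <= t * g u + (1 - t) * g w) ->
  (forall j, D (z j)) ->
  D (N.+1%:R^-1 *: \sum_(j < N.+1) z j) /\
  N.+1%:R * g (N.+1%:R^-1 *: \sum_(j < N.+1) z j) <= \sum_(j < N.+1) g (z j).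
Proof.
move=> cvx Dz; elim: N => [|N [ID IH]].
  by rewrite !big_ord_recl !big_ord0 !addr0 invr1 scale1r mul1r.
rewrite big_ord_recr [X in _ /\ _ <= X]big_ord_recr /=.
set S := \sum_(j < N.+1) z j in ID IH *; set Sg := \sum_(j < N.+1) g (z j) in IH *.
have n0 : 0 < N.+1%:R :> R by [].
rewrite -[N.+2%:R]natr1; move: n0 IH ID; set a : R := N.+1%:R => a0 IH ID.
have a1 : 0 < a + 1 by lra.
have t01 : 0 < a / (a + 1) < 1 by rewrite divr_gt0//= ltr_pdivrMr//; lra.
have -> : (a + 1)^-1 *: (S + z N.+1) =
    (a / (a + 1)) *: (a^-1 *: S) + (1 - a / (a + 1)) *: z N.+1.
  rewrite scalerDr scalerA; congr (_ *: _ + _ *: _).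
    by rewrite mulrAC divff ?gt_eqF// mul1r.
  by field; rewrite gt_eqF.
have [DD le] := cvx _ _ _ ID (Dz N.+1) t01; split=> //.
apply: (le_trans (_ : _ <= (a + 1) *
  (a / (a + 1) * g (a^-1 *: S) + (1 - a / (a + 1)) * g (z N.+1)))).
  by rewrite ler_pM2l.
have -> : (a + 1) * (a / (a + 1) * g (a^-1 *: S) + (1 - a / (a + 1)) * g (z N.+1)) =
  a * g (a^-1 *: S) + g (z N.+1) by field; rewrite gt_eqF.
by rewrite lerD2r.
Qed.

Lemma avg_iter_cst {R : realType} {p : nat} (gam : R) (z : nat -> 'rV[R]_p) (N : nat) :
  0 < gam -> avg_iter (fun _ => gam) z N.+1 = N.+1%:R^-1 *: \sum_(j < N.+1) z j.+1.
Proof.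
move=> gam0; rewrite /avg_iter scaler_sumr big_add1 /= big_mkord.
apply: eq_bigr => j _; congr (_ *: _).
rewrite sumr_const_nat subn1 /= -[gam *+ _]mulr_natr invfM mulrA divff ?mul1r//.
by rewrite gt_eqF.
Qed.

Lemma convex_fine_add {R : realType} {p : nat} (h : 'rV[R]_p -> \bar R) (g : 'rV[R]_p -> R)
  u w t : proper_fun h -> convex_ext h ->
  (forall x1 x2 (t : R), edom h x1 -> edom h x2 -> 0 <= t <= 1 ->
     g (t *: x1 + (1 - t) *: x2) <= t * g x1 + (1 - t) * g x2) ->
  edom h u -> edom h w -> 0 < t < 1 ->
  edom h (t *: u + (1 - t) *: w) /\
  fine (h (t *: u + (1 - t) *: w)) + g (t *: u + (1 - t) *: w) <=
    t * (fine (h u) + g u) + (1 - t) * (fine (h w) + g w).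
Proof.
move=> ph ch cg hu hw t01; have [hd hle] := convex_fine ph ch hu hw t01; split=> //.
have := cg u w t hu hw; case/andP: t01 => /ltW -> /ltW -> /(_ isT); lra.
Qed.

(** * Convergence of the method *)

Section SAPS.
Context {R : realType} {n m : nat} {d dX : measure_display} {Omega : measurableType d}
  (P : probability Omega R) {Xi : measurableType dX}.
Variables (th : 'rV[R]_n -> \bar R) (om : 'rV[R]_m -> \bar R)
  (f : 'rV[R]_n -> 'rV[R]_m -> R) (xi0 : Omega -> Xi) (xi : nat -> Omega -> Xi)
  (Gx : 'rV[R]_n -> 'rV[R]_m -> Xi -> 'rV[R]_n)
  (Gy : 'rV[R]_n -> 'rV[R]_m -> Xi -> 'rV[R]_m)
  (xs : 'rV[R]_n) (ys : 'rV[R]_m) (M : R).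
Hypotheses (pth : proper_fun th) (lth : lower_semicontinuous th) (cth : convex_ext th)
  (pom : proper_fun om) (lom : lower_semicontinuous om) (com : convex_ext om).
Hypothesis mxi0 : measurable_fun setT xi0.
Hypothesis cf : {within [set z : 'rV[R]_n * 'rV[R]_m | edom th z.1 /\ edom om z.2],
  continuous (fun z : 'rV[R]_n * 'rV[R]_m => f z.1 z.2)}.
Hypothesis fx_convex : forall y x1 x2 (t : R),
  edom om y -> edom th x1 -> edom th x2 -> 0 <= t <= 1 ->
  f (t *: x1 + (1 - t) *: x2) y <= t * f x1 y + (1 - t) * f x2 y.
Hypothesis fy_concave : forall x y1 y2 (t : R),
  edom th x -> edom om y1 -> edom om y2 -> 0 <= t <= 1 ->
  t * f x y1 + (1 - t) * f x y2 <= f x (t *: y1 + (1 - t) *: y2).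
Hypothesis iid : iid_copies P xi xi0.
Hypotheses (mGx : oracle_measurable Gx) (mGy : oracle_measurable Gy).
Hypothesis oracle : forall x y, edom th x -> edom om y ->
  (forall i, P.-integrable setT (fun w => (Gx x y (xi0 w) 0 i)%:E)) /\
  (forall i, P.-integrable setT (fun w => (Gy x y (xi0 w) 0 i)%:E)) /\
  (forall x', edom th x' ->
     f x y + dotv (vexpect P (fun w => Gx x y (xi0 w))) (x' - x) <= f x' y) /\
  (forall y', edom om y' ->
     f x y' <= f x y + dotv (vexpect P (fun w => Gy x y (xi0 w))) (y' - y)).
Hypotheses (dxs : edom th xs) (dys : edom om ys).
Hypothesis saddle : forall x y, edom th x -> edom om y ->
  (phi th om f xs y <= phi th om f xs ys)%E /\ (phi th om f xs ys <= phi th om f x ys)%E.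
Hypothesis second_moment : forall x y, edom th x -> edom om y ->
  exists (vx : 'rV[R]_n) (vy : 'rV[R]_m),
    subgrad th x vx /\ subgrad om y vy /\
    (\int[P]_(w in setT)
       ((sqn (vx + Gx x y (xi0 w)) + sqn (vy - Gy x y (xi0 w)))%:E) <= (M ^+ 2)%:E)%E.
Variables (gam : R) (x1 : 'rV[R]_n) (y1 : 'rV[R]_m).
Hypotheses (gam0 : 0 < gam) (dx1 : edom th x1) (dy1 : edom om y1).
Variables (prx : 'rV[R]_n -> 'rV[R]_n) (pry : 'rV[R]_m -> 'rV[R]_m).
Hypotheses (prxP : forall u, is_prox gam th u (prx u))
  (pryP : forall u, is_prox gam om u (pry u)).

(** The gap splits into a convex function of x and a convex function of y, so Jensen's inequality
    applies to each variable separately. *)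
Definition primal_part x := fine (th x) + f x ys.
Definition dual_part y := fine (om y) - f xs y.

Definition saddle_gap x y : R := (primal_part x + dual_part y) - (fine (om ys) + fine (th xs)).

Lemma phiE x y : edom th x -> edom om y ->
  phi th om f x y = (fine (th x) + f x y - fine (om y))%:E.
Proof.
by move=> dx dy; rewrite /phi -(edom_fineK pth dx) -(edom_fineK pom dy).
Qed.

Lemma phi_gap x y : edom th x -> edom om y ->
  (phi th om f x ys - phi th om f xs y)%E = (saddle_gap x y)%:E.
Proof.
move=> dx dy; rewrite !phiE// -EFinB; congr (_%:E).
by rewrite /saddle_gap /primal_part /dual_part; ring.
Qed.

Lemma saddle_gap_ge0 x y : edom th x -> edom om y -> 0 <= saddle_gap x y.
Proof.
move=> dx dy; have [] := saddle dx dy; rewrite !phiE// !lee_fin.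
rewrite /saddle_gap /primal_part /dual_part; lra.
Qed.

Lemma primal_part_convex u w t : edom th u -> edom th w -> 0 < t < 1 ->
  edom th (t *: u + (1 - t) *: w) /\
  primal_part (t *: u + (1 - t) *: w) <= t * primal_part u + (1 - t) * primal_part w.
Proof.
apply: (convex_fine_add (g := fun x => f x ys) pth cth) => x x' t' dx dx' t01; exact: fx_convex.
Qed.

Lemma dual_part_convex u w t : edom om u -> edom om w -> 0 < t < 1 ->
  edom om (t *: u + (1 - t) *: w) /\
  dual_part (t *: u + (1 - t) *: w) <= t * dual_part u + (1 - t) * dual_part w.
Proof.
apply: (convex_fine_add (g := fun y => - f xs y) pom com) => y y' t' dy dy' t01.
by have := fy_concave dxs dy dy' t01; lra.
Qed.

Lemma measurable_gap d' (T : measurableType d') (U : T -> 'rV[R]_n) (V : T -> 'rV[R]_m) :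
  rV_measurable U -> rV_measurable V ->
  (forall t, edom th (U t)) -> (forall t, edom om (V t)) ->
  measurable_fun setT (fun t => saddle_gap (U t) (V t)).
Proof.
move=> mU mV dU dV.
have /subspace_continuousP cf' := cf.
(* Joint continuity on the product domain is restricted to the slices through [ys] and [xs], the
   only ones entering the gap. *)
have cx : {within edom th, continuous (f ^~ ys)}.
  apply/subspace_continuousP => x dx A /(cf' (x, ys) (conj dx dys)).
  move=> [[V1 V2] /= [xV1 yV2] sV]; rewrite nbhs_simpl /=.
  apply: filterS xV1 => x' V1x' dx'.
  by apply: (sV (x', ys)) => //; split => //=; exact: nbhs_singleton.
have cy : {within edom om, continuous (f xs)}.
  apply/subspace_continuousP => y dy A /(cf' (xs, y) (conj dxs dy)).
  move=> [[V1 V2] /= [xV1 yV2] sV]; rewrite nbhs_simpl /=.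
  apply: filterS yV2 => y' V2y' dy'.
  by apply: (sV (xs, y')) => //; split => //=; exact: nbhs_singleton.
apply: measurable_funB => //; apply: measurable_funD.
  apply: measurable_funD; first exact: measurable_fine_lsc.
  exact: (measurable_continuous_within mU dU cx).
apply: measurable_funB; first exact: measurable_fine_lsc.
exact: (measurable_continuous_within mV dV cy).
Qed.

Definition saps_step (z : 'rV[R]_n * 'rV[R]_m) (s : Xi) :=
  (prx (z.1 - gam *: Gx z.1 z.2 s), pry (z.2 + gam *: Gy z.1 z.2 s)).

Definition sqdist (z : 'rV[R]_n * 'rV[R]_m) : R := sqn (z.1 - xs) + sqn (z.2 - ys).

Lemma sqdist_ge0 z : 0 <= sqdist z.
Proof. by rewrite addr_ge0// sqn_ge0. Qed.

Lemma saps_step_measurable d' (T : measurableType d') (U : T -> 'rV[R]_n * 'rV[R]_m) (S : T -> Xi) :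
  rV_measurable (fun t => (U t).1) -> rV_measurable (fun t => (U t).2) ->
  measurable_fun setT S ->
  rV_measurable (fun t => (saps_step (U t) (S t)).1) /\
  rV_measurable (fun t => (saps_step (U t) (S t)).2).
Proof.
move=> mU1 mU2 mS; split; apply: rV_measurable_nonexpansive.
- by move=> u v; exact: (prox_nonexpansive gam0 pth cth (prxP _) (prxP _)).
- apply: rV_measurableD => //; apply: rV_measurableN; apply: rV_measurableZ.
  exact: mGx.
- by move=> u v; exact: (prox_nonexpansive gam0 pom com (pryP _) (pryP _)).
- apply: rV_measurableD => //; apply: rV_measurableZ.
  exact: mGy.
Qed.

Lemma sqdist_measurable d' (T : measurableType d') (U : T -> 'rV[R]_n * 'rV[R]_m) :
  rV_measurable (fun t => (U t).1) -> rV_measurable (fun t => (U t).2) ->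
  measurable_fun setT (fun t => sqdist (U t)).
Proof.
move=> mU1 mU2; apply: measurable_funD; apply: measurable_sqn;
  by apply: rV_measurableD => //; exact: rV_measurable_cst.
Qed.

(* The subgradients of assumption (A4) are chosen for one fixed z, so their choice need
   not be measurable in z. *)
Lemma expected_descent z : edom th z.1 -> edom om z.2 ->
  (\int[P]_w (sqdist (saps_step z (xi0 w)))%:E + (2 * gam * saddle_gap z.1 z.2)%:E <=
   (sqdist z + gam ^+ 2 * M ^+ 2)%:E)%E.
Proof.
case: z => x y /= dx dy.
have [vx [vy [svx [svy Evv]]]] := second_moment dx dy.
have [iGx [iGy [subx supy]]] := oracle dx dy.
have mc p (u : 'rV[R]_p) : rV_measurable (fun _ : Omega => u) by exact: rV_measurable_cst.
have mX : rV_measurable (fun w => Gx x y (xi0 w)) by exact: mGx.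
have mY : rV_measurable (fun w => Gy x y (xi0 w)) by exact: mGy.
pose sq w := sqn (vx + Gx x y (xi0 w)) + sqn (vy - Gy x y (xi0 w)).
have sq0 w : 0 <= sq w by rewrite addr_ge0// sqn_ge0.
have msq : measurable_fun setT sq.
  apply: measurable_funD; apply: measurable_sqn; apply: rV_measurableD => //.
  exact: rV_measurableN.
have isq : P.-integrable setT (EFin \o sq).
  apply/integrableP; split; first exact/measurable_EFinP.
  under eq_integral do rewrite /= ger0_norm//.
  exact: le_lt_trans Evv (ltry _).
have Esq : Rintegral P setT sq <= M ^+ 2.
  by rewrite -lee_fin /Rintegral fineK//; exact: integrable_fin_num.
have [ilx Elx] := expect_dotv (x - xs) iGx.
have [ily Ely] := expect_dotv (y - ys) iGy.
pose lin w := dotv (Gx x y (xi0 w)) (x - xs) - dotv (Gy x y (xi0 w)) (y - ys).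
have ilin : P.-integrable setT (EFin \o lin).
  apply: eq_integrable (integrableB measurableT ilx ily) => //.
(* The mean of [lin] is <g(z), z - zs> with zs = (xs, ys); the subgradient inequality in x at [xs]
   and the supergradient one in y at [ys] add up, and f x y cancels. *)
have Elin : f x ys - f xs y <= Rintegral P setT lin.
  rewrite RintegralB// Elx Ely.
  have := subx _ dxs; have := supy _ dys.
  rewrite -[xs - x]opprB -[ys - y]opprB !dotvNr; lra.
pose K := sqdist (x, y) - 2 * gam * (fine (th x) - fine (th xs) + (fine (om y) - fine (om ys))).
pose rhs w := K + (gam ^+ 2 * sq w - 2 * gam * lin w).
have icst (c : R) : P.-integrable setT (EFin \o cst c).
  exact: finite_measure_integrable_cst.
have isq2 : P.-integrable setT (EFin \o (fun w => gam ^+ 2 * sq w)).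
  by apply: eq_integrable (integrableZl _ (gam ^+ 2) isq).
have ilin2 : P.-integrable setT (EFin \o (fun w => 2 * gam * lin w)).
  by apply: eq_integrable (integrableZl _ (2 * gam) ilin).
have idiff : P.-integrable setT (EFin \o (fun w => gam ^+ 2 * sq w - 2 * gam * lin w)).
  by apply: eq_integrable (integrableB _ isq2 ilin2).
have irhs : P.-integrable setT (EFin \o rhs).
  by apply: eq_integrable (integrableD _ (icst K) idiff).
have Erhs : Rintegral P setT rhs =
    K + (gam ^+ 2 * Rintegral P setT sq - 2 * gam * Rintegral P setT lin).
  rewrite -(RintegralZl (gam ^+ 2) measurableT isq) -(RintegralZl (2 * gam) measurableT ilin).
  rewrite -(RintegralB measurableT isq2 ilin2).
  have EK : Rintegral P setT (cst K) = K.
    by rewrite Rintegral_cst//= probability_setT mulr1.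
  by rewrite -[K in RHS]EK; exact: (RintegralD measurableT (icst K) idiff).
have le_rhs w : sqdist (saps_step (x, y) (xi0 w)) <= rhs w.
  have := prox_step gam0 pth cth dx dxs svx (prxP (x - gam *: Gx x y (xi0 w))).
  (* The ascent step in y is a descent step along [- Gy]. *)
  have py : is_prox gam om (y - gam *: - Gy x y (xi0 w)) (pry (y + gam *: Gy x y (xi0 w))).
    by rewrite scalerN opprK.
  have := prox_step gam0 pom com dy dys svy py.
  rewrite /rhs /K /lin /sq /sqdist /= dotvNl; lra.
apply: (@le_trans _ _ ((Rintegral P setT rhs)%:E + (2 * gam * saddle_gap x y)%:E)%E).
  apply: leeD => //; rewrite /Rintegral fineK; last exact: integrable_fin_num.
  apply: ge0_le_integral => //.
  - by move=> w _; rewrite lee_fin sqdist_ge0.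
  - apply/measurable_EFinP; apply: sqdist_measurable;
      by have [] := saps_step_measurable (U := fun=> (x, y)) (mc _ x) (mc _ y) mxi0.
  - by have /integrableP[] := irhs.
  - by move=> w _; rewrite lee_fin.
rewrite -EFinD lee_fin Erhs.
have := ler_wpM2l (ltW gam0) Elin.
have := ler_wpM2l (sqr_ge0 gam) Esq.
rewrite /K /saddle_gap /primal_part /dual_part; lra.
Qed.

(* Shifted indexing: saps_iter k is the iterate z^{k+1} and depends on xi 1, ..., xi k. *)
Fixpoint saps_iter (k : nat) (w : Omega) :=
  if k is j.+1 then saps_step (saps_iter j w) (xi j.+1 w) else (x1, y1).

Lemma saps_iter_edom k w : edom th (saps_iter k w).1 /\ edom om (saps_iter k w).2.
Proof.
case: k => [//|k] /=; split; first exact: prox_edom pth (prxP _).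
exact: prox_edom pom (pryP _).
Qed.

(** This is adaptedness: measurability for [past xi k] persists for [past xi k.+1], where the new
    sample is measurable too. *)
Lemma saps_iter_past k :
  rV_measurable (fun w : g_sigma_algebraType (past xi k) => (saps_iter k w).1) /\
  rV_measurable (fun w : g_sigma_algebraType (past xi k) => (saps_iter k w).2).
Proof.
elim: k => [|k [IH1 IH2]]; first by split=> i; exact: measurable_cst.
apply: (@saps_step_measurable _ (g_sigma_algebraType (past xi k.+1)) (saps_iter k)).
- by move=> i; exact: measurable_pastS (IH1 i).
- by move=> i; exact: measurable_pastS (IH2 i).
- exact: measurable_past_next.
Qed.

Lemma saps_iter_measurable k :
  rV_measurable (fun w => (saps_iter k w).1) /\ rV_measurable (fun w => (saps_iter k w).2).
Proof.
have [m1 m2] := saps_iter_past k.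
by split=> i; [exact: (measurable_past iid (m1 i))|exact: (measurable_past iid (m2 i))].
Qed.

Lemma saps_iter_gap_measurable k :
  measurable_fun setT (fun w => saddle_gap (saps_iter k w).1 (saps_iter k w).2).
Proof.
have [m1 m2] := saps_iter_measurable k.
by apply: measurable_gap => // w; have [] := saps_iter_edom k w.
Qed.

Lemma descent k :
  (\int[P]_w (sqdist (saps_iter k.+1 w))%:E +
   (2 * gam)%:E * \int[P]_w (saddle_gap (saps_iter k w).1 (saps_iter k w).2)%:E <=
   \int[P]_w (sqdist (saps_iter k w))%:E + (gam ^+ 2 * M ^+ 2)%:E)%E.
Proof.
have [m1 m2] := saps_iter_measurable k.
have [p1 p2] := saps_iter_past k.
have gap0 w : 0 <= saddle_gap (saps_iter k w).1 (saps_iter k w).2.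
  by have [] := saps_iter_edom k w; exact: saddle_gap_ge0.
have mgap := saps_iter_gap_measurable k.
pose H w s : \bar R := (sqdist (saps_step (saps_iter k w) s))%:E.
have H0 w s : (0 <= H w s)%E by rewrite lee_fin sqdist_ge0.
(* General in T because it serves twice: on the product of the past with Xi, to freeze the iterate,
   and on the product of Omega with itself, to make the inner integral measurable. *)
have mH d' (T : measurableType d') (U : T -> Omega) (S : T -> Xi) :
    rV_measurable (fun t => (saps_iter k (U t)).1) ->
    rV_measurable (fun t => (saps_iter k (U t)).2) ->
    measurable_fun setT S -> measurable_fun setT (fun t => H (U t) (S t)).
  move=> mU1 mU2 mS; apply/measurable_EFinP; apply: sqdist_measurable;
    by have [] := saps_step_measurable (U := fun t => saps_iter k (U t)) mU1 mU2 mS.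
rewrite (integral_past iid mxi0 (k := k) (H := H))//; last first.
  apply: mH.
  - by move=> i; exact: (measurableT_comp (p1 i) measurable_fst).
  - by move=> i; exact: (measurableT_comp (p2 i) measurable_fst).
  - exact: measurable_snd.
have mint : measurable_fun setT (fun w => \int[P]_w' H w (xi0 w'))%E.
  apply: (@measurable_fun_fubini_tonelli_F _ _ _ _ R P (fun z => H z.1 (xi0 z.2))) => //.
  apply: mH.
  - by move=> i; exact: (measurableT_comp (m1 i) measurable_fst).
  - by move=> i; exact: (measurableT_comp (m2 i) measurable_fst).
  - exact: (measurableT_comp mxi0 measurable_snd).
have g2 : 0 <= 2 * gam by rewrite mulr_ge0// ltW.
rewrite -ge0_integralZl//; [|exact/measurable_EFinP|by move=> w _; rewrite lee_fin].
rewrite -ge0_integralD//; first last.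
- by apply: measurable_funeM; exact/measurable_EFinP.
- by move=> w _; rewrite mule_ge0// lee_fin.
- by move=> w _; exact: integral_ge0.
have c0 : 0 <= gam ^+ 2 * M ^+ 2 by rewrite mulr_ge0// sqr_ge0.
have mdist : measurable_fun setT (fun w => (sqdist (saps_iter k w))%:E).
  by apply/measurable_EFinP; exact: sqdist_measurable.
have -> : (\int[P]_w (sqdist (saps_iter k w))%:E + (gam ^+ 2 * M ^+ 2)%:E =
    \int[P]_w ((sqdist (saps_iter k w))%:E + cst (gam ^+ 2 * M ^+ 2)%:E w))%E.
  rewrite ge0_integralD//; last by move=> w _; rewrite lee_fin sqdist_ge0.
  by rewrite integral_cst// [X in (_ + _ * X)%E](probability_setT P) mule1.
apply: ge0_le_integral => //.
- move=> w _; rewrite adde_ge0 ?integral_ge0// mule_ge0// lee_fin//.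
- by apply: emeasurable_funD => //; apply: measurable_funeM; exact/measurable_EFinP.
- exact: emeasurable_funD.
move=> w _; rewrite -EFinM -EFinD.
by have [e1 e2] := saps_iter_edom k w; exact: expected_descent.
Qed.

(** Telescoping of [descent] in additive form: expected distances are extended reals here, so they
    are added and never subtracted. *)
Lemma sum_gap_le K :
  (\int[P]_w (sqdist (saps_iter K w))%:E +
   (2 * gam)%:E * \sum_(k < K)
     \int[P]_w (saddle_gap (saps_iter k w).1 (saps_iter k w).2)%:E <=
   (sqdist (x1, y1) + K%:R * (gam ^+ 2 * M ^+ 2))%:E)%E.
Proof.
elim: K => [|K IH].
  rewrite big_ord0 mule0 adde0 mul0r addr0 /=.
  by rewrite integral_cst// [X in (_ * X <= _)%E](probability_setT P) mule1.
rewrite big_ord_recr /= ge0_muleDr; last 2 first.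
- apply: sume_ge0 => k _; apply: integral_ge0 => w _; rewrite lee_fin.
  by have [] := saps_iter_edom k w; exact: saddle_gap_ge0.
- apply: integral_ge0 => w _; rewrite lee_fin.
  by have [] := saps_iter_edom K w; exact: saddle_gap_ge0.
rewrite [X in (_ + X <= _)%E]addeC addeA.
apply: (le_trans (leeD2r _ (descent K))).
have -> : sqdist (x1, y1) + K.+1%:R * (gam ^+ 2 * M ^+ 2) =
    sqdist (x1, y1) + K%:R * (gam ^+ 2 * M ^+ 2) + gam ^+ 2 * M ^+ 2.
  by rewrite -[K.+1%:R]natr1; ring.
by rewrite addeAC [leRHS]EFinD; exact: leeD2r.
Qed.

Lemma expected_gap_mean N :
  (\int[P]_w (saddle_gap
      (N.+1%:R^-1 *: \sum_(j < N.+1) (saps_iter j w).1)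
      (N.+1%:R^-1 *: \sum_(j < N.+1) (saps_iter j w).2))%:E <=
   ((sqdist (x1, y1) + N.+1%:R * (gam ^+ 2 * M ^+ 2)) / (2 * gam * N.+1%:R))%:E)%E.
Proof.
pose ax w := N.+1%:R^-1 *: \sum_(j < N.+1) (saps_iter j w).1.
pose ay w := N.+1%:R^-1 *: \sum_(j < N.+1) (saps_iter j w).2.
rewrite -[leLHS]/(\int[P]_w (saddle_gap (ax w) (ay w))%:E)%E.
have jx w := jensen_mean (z := fun j => (saps_iter j w).1) N primal_part_convex
  (fun j => (saps_iter_edom j w).1).
have jy w := jensen_mean (z := fun j => (saps_iter j w).2) N dual_part_convex
  (fun j => (saps_iter_edom j w).2).
have gap0 w : 0 <= saddle_gap (ax w) (ay w).
  by apply: saddle_gap_ge0; [have [] := jx w|have [] := jy w].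
have mgap : measurable_fun setT (fun w => saddle_gap (ax w) (ay w)).
  apply: measurable_gap.
  - apply: rV_measurableZ; apply: rV_measurable_sum => j.
    by have [] := saps_iter_measurable j.
  - apply: rV_measurableZ; apply: rV_measurable_sum => j.
    by have [] := saps_iter_measurable j.
  - by move=> w; have [] := jx w.
  - by move=> w; have [] := jy w.
have gapk0 (k : nat) w : (0 <= (saddle_gap (saps_iter k w).1 (saps_iter k w).2)%:E)%E.
  by have [] := saps_iter_edom k w; rewrite lee_fin; exact: saddle_gap_ge0.
have N0 : 0 < N.+1%:R :> R by [].
have g0 : 0 < 2 * gam * N.+1%:R by rewrite !mulr_gt0.
rewrite mulrC EFinM lee_pdivlMl// EFinM -muleA.
apply: le_trans _ (sum_gap_le N.+1).
(* The final expected distance is nonnegative and is dropped. *)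
apply: le_trans _ (leeDr _ _); last first.
  by apply: integral_ge0 => w _; rewrite lee_fin sqdist_ge0.
apply: lee_wpmul2l; first by rewrite lee_fin mulr_ge0// ltW.
rewrite -ge0_integralZl//; [|exact/measurable_EFinP|by move=> w _; rewrite lee_fin].
rewrite -(@ge0_integral_sum _ _ _ P setT measurableT 'I_N.+1 (fun k w =>
  (saddle_gap (saps_iter k w).1 (saps_iter k w).2)%:E))//; last first.
  by move=> k; apply/measurable_EFinP; exact: saps_iter_gap_measurable.
apply: ge0_le_integral => //.
- by move=> w _; rewrite mule_ge0// lee_fin.
- by apply: measurable_funeM; exact/measurable_EFinP.
- apply: emeasurable_sum => k; apply/measurable_EFinP.
  exact: saps_iter_gap_measurable.
move=> w _; rewrite -EFinM sumEFin lee_fin.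
have [_ lx] := jx w; have [_ ly] := jy w.
rewrite /saddle_gap mulrBr mulrDr sumrB big_split /= sumr_const card_ord.
by apply: lerB; [exact: lerD|rewrite mulr_natl].
Qed.

(** Uniqueness of proximal points identifies the given z^1, ..., z^N with the recursion, whose
    measurability they thereby inherit. *)
Lemma saps_iter_unique N (x : nat -> Omega -> 'rV[R]_n) (y : nat -> Omega -> 'rV[R]_m) :
  (forall w, x 1%N w = x1 /\ y 1%N w = y1) ->
  (forall k w, (1 <= k < N)%N ->
     is_prox gam th (x k w - gam *: Gx (x k w) (y k w) (xi k w)) (x k.+1 w) /\
     is_prox gam om (y k w + gam *: Gy (x k w) (y k w) (xi k w)) (y k.+1 w)) ->
  forall k w, (k < N)%N -> (x k.+1 w, y k.+1 w) = saps_iter k w.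
Proof.
move=> init next; elim=> [|k IH] w kN; first by have [-> ->] := init w.
have [px py] := next k.+1 w kN.
rewrite /= -IH ?(ltnW kN)// /saps_step /=; congr (_, _).
  exact: (prox_unique gam0 pth cth px (prxP _)).
exact: (prox_unique gam0 pom com py (pryP _)).
Qed.

Lemma expected_optimality_gap N (x : nat -> Omega -> 'rV[R]_n) (y : nat -> Omega -> 'rV[R]_m) :
  (0 < N)%N ->
  (forall w, x 1%N w = x1 /\ y 1%N w = y1) ->
  (forall k w, (1 <= k < N)%N ->
     is_prox gam th (x k w - gam *: Gx (x k w) (y k w) (xi k w)) (x k.+1 w) /\
     is_prox gam om (y k w + gam *: Gy (x k w) (y k w) (xi k w)) (y k.+1 w)) ->
  (\int[P]_(w in setT)
     (phi th om f (avg_iter (fun _ => gam) (fun j => x j w) N) ys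
      - phi th om f xs (avg_iter (fun _ => gam) (fun j => y j w) N)) <=
   ((sqn (x1 - xs) + sqn (y1 - ys) + N%:R * (gam ^+ 2 * M ^+ 2)) /
      (2 * gam * N%:R))%:E)%E.
Proof.
case: N => // N _ init next; apply: le_trans _ (expected_gap_mean N).
rewrite le_eqVlt; apply/orP; left; apply/eqP; apply: eq_integral => w _.
have E := saps_iter_unique init next.
have -> : avg_iter (fun=> gam) (fun j => x j w) N.+1 =
    N.+1%:R^-1 *: \sum_(j < N.+1) (saps_iter j w).1.
  by rewrite avg_iter_cst//; congr (_ *: _); apply: eq_bigr => j _; rewrite -E.
have -> : avg_iter (fun=> gam) (fun j => y j w) N.+1 =
    N.+1%:R^-1 *: \sum_(j < N.+1) (saps_iter j w).2.
  by rewrite avg_iter_cst//; congr (_ *: _); apply: eq_bigr => j _; rewrite -E.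
apply: phi_gap.
  by have [] := jensen_mean (z := fun j => (saps_iter j w).1) N primal_part_convex
    (fun j => (saps_iter_edom j w).1).
by have [] := jensen_mean (z := fun j => (saps_iter j w).2) N dual_part_convex
  (fun j => (saps_iter_edom j w).2).
Qed.

End SAPS.

(** * Bounds for the three step sizes *)

Theorem theorem2p1
  (R : realType) (n m : nat)
  (d : measure_display) (Omega : measurableType d) (P : probability Omega R)
  (dX : measure_display) (Xi : measurableType dX)
  (th : 'rV[R]_n -> \bar R) (om : 'rV[R]_m -> \bar R)
  (F : 'rV[R]_n -> 'rV[R]_m -> Xi -> R) (f : 'rV[R]_n -> 'rV[R]_m -> R)
  (xi0 : Omega -> Xi) (xi : nat -> Omega -> Xi)
  (Gx : 'rV[R]_n -> 'rV[R]_m -> Xi -> 'rV[R]_n)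
  (Gy : 'rV[R]_n -> 'rV[R]_m -> Xi -> 'rV[R]_m)
  (xs : 'rV[R]_n) (ys : 'rV[R]_m) (M : R) :
  (* setting *)
  proper_fun th -> lower_semicontinuous th -> convex_ext th ->
  proper_fun om -> lower_semicontinuous om -> convex_ext om ->
  measurable_fun setT xi0 ->
  (forall x y, edom th x -> edom om y ->
     P.-integrable setT (fun w => (F x y (xi0 w))%:E) /\
     f x y = Rintegral P setT (fun w => F x y (xi0 w))) ->
  {within [set z : 'rV[R]_n * 'rV[R]_m | edom th z.1 /\ edom om z.2],
     continuous (fun z : 'rV[R]_n * 'rV[R]_m => f z.1 z.2)} ->
  (forall y x1 x2 (t : R), edom om y -> edom th x1 -> edom th x2 -> 0 <= t <= 1 ->
     f (t *: x1 + (1 - t) *: x2) y <= t * f x1 y + (1 - t) * f x2 y) ->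
  (forall x y1 y2 (t : R), edom th x -> edom om y1 -> edom om y2 -> 0 <= t <= 1 ->
     t * f x y1 + (1 - t) * f x y2 <= f x (t *: y1 + (1 - t) *: y2)) ->
  (* (A1) *)
  iid_copies P xi xi0 ->
  (* (A2) *)
  oracle_measurable Gx -> oracle_measurable Gy ->
  (forall x y, edom th x -> edom om y ->
     (forall i, P.-integrable setT (fun w => (Gx x y (xi0 w) 0 i)%:E)) /\
     (forall i, P.-integrable setT (fun w => (Gy x y (xi0 w) 0 i)%:E)) /\
     (forall x', edom th x' ->
        f x y + dotv (vexpect P (fun w => Gx x y (xi0 w))) (x' - x) <= f x' y) /\
     (forall y', edom om y' ->
        f x y' <= f x y + dotv (vexpect P (fun w => Gy x y (xi0 w))) (y' - y))) ->
  (* (A3) *)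
  edom th xs -> edom om ys ->
  (forall x y, edom th x -> edom om y ->
     (phi th om f xs y <= phi th om f xs ys)%E /\ (phi th om f xs ys <= phi th om f x ys)%E) ->
  (* (A4) *)
  0 < M ->
  (forall x y, edom th x -> edom om y ->
     exists (vx : 'rV[R]_n) (vy : 'rV[R]_m),
       subgrad th x vx /\ subgrad om y vy /\
       (\int[P]_(w in setT)
          ((sqn (vx + Gx x y (xi0 w)) + sqn (vy - Gy x y (xi0 w)))%:E)
        <= (M ^+ 2)%:E)%E) ->
  (* SAPS with constant step size gam, iterates z^1, ..., z^N *)
  forall (N : nat) (gam : R) (x1 : 'rV[R]_n) (y1 : 'rV[R]_m)
         (x : nat -> Omega -> 'rV[R]_n) (y : nat -> Omega -> 'rV[R]_m),
  (0 < N)%N -> 0 < gam ->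
  edom th x1 -> edom om y1 ->
  (forall w, x 1%N w = x1 /\ y 1%N w = y1) ->
  (forall k w, (1 <= k < N)%N ->
     is_prox gam th (x k w - gam *: Gx (x k w) (y k w) (xi k w)) (x k.+1 w) /\
     is_prox gam om (y k w + gam *: Gy (x k w) (y k w) (xi k w)) (y k.+1 w)) ->
  let D := Num.sqrt (sqn (x1 - xs) + sqn (y1 - ys)) in
  let Eeps := (\int[P]_(w in setT)
      (phi th om f (avg_iter (fun _ => gam) (fun j => x j w) N) ys
       - phi th om f xs (avg_iter (fun _ => gam) (fun j => y j w) N)))%E in
  [/\ gam = (Num.sqrt N%:R)^-1 ->
        (Eeps <= ((D ^+ 2 + M ^+ 2) / (2 * Num.sqrt N%:R))%:E)%E,
      gam = D / (M * Num.sqrt N%:R) ->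
        (Eeps <= (D * M / Num.sqrt N%:R)%:E)%E &
      forall theta : R, 0 < theta -> gam = theta * D / (M * Num.sqrt N%:R) ->
        (Eeps <= (Num.max theta theta^-1 * D * M / Num.sqrt N%:R)%:E)%E].
Proof.
move=> pth lth cth pom lom com mxi0 _ cf fx_convex fy_concave iid mGx mGy oracle dxs dys
  saddle M0 second_moment N gam x1 y1 x y N0 gam0 dx1 dy1 init next D Eeps.
(* (A4) at the starting point supplies the subgradients, hence the affine minorants, that
   [prox_exists] asks for. *)
have [vx [vy [svx [svy _]]]] := second_moment _ _ dx1 dy1.
have /choice[prx prxP] u := prox_exists u gam0 pth lth cth dx1 svx.
have /choice[pry pryP] u := prox_exists u gam0 pom lom com dy1 svy.
have bound : (Eeps <= ((D ^+ 2 + N%:R * (gam ^+ 2 * M ^+ 2)) / (2 * gam * N%:R))%:E)%E.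
  rewrite /D sqr_sqrtr ?addr_ge0 ?sqn_ge0//.
  exact: (expected_optimality_gap (Gx := Gx) (Gy := Gy) pth lth cth pom lom com mxi0 cf
    fx_convex fy_concave iid mGx mGy oracle dxs dys saddle second_moment gam0 dx1 dy1
    prxP pryP N0 init next).
have D0 : 0 <= D by exact: sqrtr_ge0.
clearbody D Eeps.
pose s : R := Num.sqrt N%:R.
have s0 : 0 < s by rewrite sqrtr_gt0 ltr0n.
have sN : N%:R = s ^+ 2 by rewrite sqr_sqrtr.
move: bound; rewrite -/s sN => bound.
have scaled theta : 0 < theta -> gam = theta * D / (M * s) ->
    (Eeps <= (Num.max theta theta^-1 * D * M / s)%:E)%E.
  move=> theta0 gamE; apply: (le_trans bound); rewrite lee_fin.
  have {}D0 : 0 < D.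
    rewrite lt_neqAle D0 andbT eq_sym; apply: contraTneq gam0 => D00.
    by rewrite gamE D00 mulr0 mul0r ltxx.
  (* For this step size the bound is the average of theta and 1 / theta times D M / s, and an
     average is at most the maximum. *)
  have -> : (D ^+ 2 + s ^+ 2 * (gam ^+ 2 * M ^+ 2)) / (2 * gam * s ^+ 2) =
      (theta + theta^-1) / 2 * (D * M / s).
    by rewrite gamE; field; rewrite !gt_eqF.
  have -> : Num.max theta theta^-1 * D * M / s = Num.max theta theta^-1 * (D * M / s).
    by rewrite !mulrA.
  rewrite ler_pM2r ?divr_gt0 ?mulr_gt0//.
  have h1 : theta <= Num.max theta theta^-1 by rewrite le_max lexx.
  have h2 : theta^-1 <= Num.max theta theta^-1 by rewrite le_max lexx orbT.
  lra.
split=> //.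
- move=> gamE; apply: (le_trans bound); rewrite lee_fin le_eqVlt; apply/orP; left.
  by apply/eqP; rewrite gamE; field; rewrite gt_eqF.
(* Case (b) is case (c) with theta = 1. *)
- move=> gamE; have := scaled 1 ltr01; rewrite invr1 maxxx !mul1r; exact.
Qed.
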